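(* Let $F$ be a field, let $n\ge1$, let $A = Fe_1\oplus\ldots\oplus Fe_n$ be the direct sum of $n$ copies of $F$, and let $R$ be a Rota–Baxter operator of weight $\lambda\in F$ on $A$. Then, as $F$-algebras, $$A^R\cong\begin{cases}\mathrm{Ab}_n, & \lambda=0,\\ A, & \lambda\neq0.\end{cases}$$
   Context: $A = Fe_1\oplus\ldots\oplus Fe_n$ is the $F$-algebra $F^n$ with $e_ie_j=\delta_{ij}e_i$. A Rota–Baxter operator of weight $\lambda$ on $A$ is an $F$-linear map $R\colon A\to A$ with $R(x)R(y) = R(R(x)y + xR(y) + \lambda xy)$ for all $x,y\in A$. For such $R$, $A^R$ denotes the vector space $A$ equipped with the (associative) product $x\circ_R y = R(x)y + xR(y) + \lambda xy$. $\mathrm{Ab}_n$ denotes the $n$-dimensional $F$-algebra with zero product. *)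

(* Defs.v *)
From mathcomp Require Import all_boot all_order all_algebra.

Set Implicit Arguments.
Unset Strict Implicit.
Unset Printing Implicit Defensive.

Import GRing.Theory.
Local Open Scope ring_scope.

(* MathComp's [algType] is unital, whereas the zero-product algebra (and a
   priori the algebra induced by a Rota-Baxter operator) has no unit; hence
   this structure of associative, not necessarily unital, F-algebra. *)
Record assocAlg (F : fieldType) := AssocAlg {
  carrier :> lmodType F;
  amul : carrier -> carrier -> carrier;
  amul_bilinear : bilinear_for *:%R *:%R amul;
  amulA : associative amul
}.

Definition alg_isomorphic (F : fieldType) (A B : assocAlg F) : Prop :=
  exists f : {linear A -> B},
    bijective f /\ (forall x y : A, f (amul x y) = amul (f x) (f y)).

Section DirectSum.
Variables (F : fieldType) (n : nat).

(* F^o is F viewed as a vector space over itself; the ring product of finite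
   functions is the componentwise one. *)
Local Notation Fn := {ffun 'I_n -> F^o}.

Fact Fn_mul_bilinear : bilinear_for *:%R *:%R (fun x y : Fn => x * y).
Proof.
split=> [y a x x' | x a y y']; apply/ffunP=> i; rewrite !ffunE.
  by rewrite mulrDl -scalerAl.
by rewrite mulrDr -scalerAr.
Qed.

Fact Fn_zero_bilinear : bilinear_for *:%R *:%R (fun _ _ : Fn => 0 : Fn).
Proof. by split=> ? a ? ? /=; rewrite [_ a 0]scaler0 addr0. Qed.

Definition FnAlg : assocAlg F := AssocAlg Fn_mul_bilinear (@mulrA Fn).

Definition Ab : assocAlg F :=
  @AssocAlg F Fn (fun _ _ => 0) Fn_zero_bilinear (fun _ _ _ => erefl).

Definition idem (i : 'I_n) : FnAlg := [ffun j => (i == j)%:R].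

Fact idemM (i j : 'I_n) : amul (idem i) (idem j) = (i == j)%:R *: idem i.
Proof.
apply/ffunP=> k; rewrite !ffunE.
case: (eqVneq i j) => [<-|ij]; first by rewrite scale1r -natrM mulnb andbb.
rewrite scale0r -natrM mulnb; case: (eqVneq i k) => // <-.
by rewrite eq_sym (negbTE ij).
Qed.

Fact idem_sum (x : FnAlg) : x = \sum_i (x : Fn) i *: idem i.
Proof.
apply/ffunP=> k; rewrite sum_ffunE (bigD1 k) //= big1 ?addr0 => [|i ik].
  by rewrite !ffunE eqxx -[_ *: _]/(_ * _) mulr1.
by rewrite !ffunE (negbTE ik) scaler0.
Qed.

End DirectSum.

Section RotaBaxter.
Variables (F : fieldType) (A : assocAlg F).

Definition rb_mul (lambda : F) (R : A -> A) (x y : A) : A :=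
  amul (R x) y + amul x (R y) + lambda *: amul x y.

Definition rota_baxter (lambda : F) (R : A -> A) : Prop :=
  forall x y : A,
    amul (R x) (R y) = R (amul (R x) y + amul x (R y) + lambda *: amul x y).

Let amulDl (x y z : A) : amul (x + y) z = amul x z + amul y z.
Proof. by have := (amul_bilinear A).1 z 1 x y; rewrite /= !scale1r. Qed.

Let amulDr (x y z : A) : amul x (y + z) = amul x y + amul x z.
Proof. by have := (amul_bilinear A).2 x 1 y z; rewrite /= !scale1r. Qed.

Let amul0l (x : A) : amul 0 x = 0.
Proof. by apply: (addrI (amul 0 x)); rewrite -amulDl !addr0. Qed.

Let amul0r (x : A) : amul x 0 = 0.
Proof. by apply: (addrI (amul x 0)); rewrite -amulDr !addr0. Qed.

Let amulZl a (x y : A) : amul (a *: x) y = a *: amul x y.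
Proof. by have := (amul_bilinear A).1 y a x 0; rewrite /= !addr0 amul0l addr0. Qed.

Let amulZr a (x y : A) : amul x (a *: y) = a *: amul x y.
Proof. by have := (amul_bilinear A).2 x a y 0; rewrite /= !addr0 amul0r addr0. Qed.

Variables (lambda : F) (R : {linear A -> A}).

Fact rb_mul_bilinear : bilinear_for *:%R *:%R (rb_mul lambda R).
Proof.
have shuffle (a : F) (u u' v v' w w' : A) :
    a *: u + u' + (a *: v + v') + lambda *: (a *: w + w') =
    a *: (u + v + lambda *: w) + (u' + v' + lambda *: w').
  rewrite !scalerDr !scalerA [lambda * a]mulrC.
  by rewrite [LHS](AC (2*2*2) ((1*3*5)*(2*4*6))).
split=> z a x y; rewrite /rb_mul /= linearP !(amulDl, amulDr, amulZl, amulZr);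
  exact: shuffle.
Qed.

Hypothesis rbR : rota_baxter lambda R.

Fact rb_mulA : associative (rb_mul lambda R).
Proof.
move=> x y z.
have R_mul u v : R (rb_mul lambda R u v) = amul (R u) (R v) by rewrite rbR.
rewrite [LHS]/rb_mul [RHS]/rb_mul !R_mul /rb_mul.
rewrite !(amulDl, amulDr, amulZl, amulZr) !scalerDr !amulA.
by rewrite [LHS](AC (3*1*3) (1*(2*4*6)*(3*5*7))).
Qed.

Definition rb_alg : assocAlg F := AssocAlg rb_mul_bilinear rb_mulA.

End RotaBaxter.

(* Main.v *)
Require Import Defs.
From HB Require Import structures.
From mathcomp Require Import all_boot all_order all_algebra.

(** Both cases rest on interpolation: distinct nonzero multiplicative
    functionals (characters) of a finite-dimensional algebra can be separated
    by elements of the algebra, without any unit. [R] and [R + lambda id] are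
    homomorphisms from [A^R] to [F^n], so their coordinates are characters of
    [A^R].
    If [lambda != 0], these characters have no common zero, since the
    difference of the two homomorphisms is [lambda id]; hence the distinct
    nonzero ones among them give an isomorphism from [A^R] onto a power of [F],
    which is [F^n] for dimension reasons.
    If [lambda = 0] and [R != 0], interpolating between the coordinates of [R]
    yields an idempotent [e = R x != 0]. Then [e = e^2 = R (2 e x)], and
    replacing [x] by [2 e x] one may assume [e x = x], so
    [e = e^2 = R (2 x) = 2 e], a contradiction; thus [R = 0]. *)

Set Implicit Arguments.
Unset Strict Implicit.
Unset Printing Implicit Defensive.

Import GRing.Theory.
Local Open Scope ring_scope.

Section Characters.
Variables (F : fieldType) (V : vectType F) (mul : V -> V -> V).

Definition character (chi : 'Hom(V, F^o)) : Prop :=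
  forall x y, chi (mul x y) = (chi x : F) * chi y.

(** Induction on [s]: an element [b] that works for the tail is corrected so as to be killed by the
    head [psi] as well. *)
Lemma character_interpolation (chi : 'Hom(V, F^o)) (s : seq 'Hom(V, F^o)) :
    chi != 0 -> chi \notin s -> character chi ->
    {in s, forall psi, character psi} ->
  exists2 b, chi b = 1 & {in s, forall psi : 'Hom(V, F^o), psi b = 0}.
Proof.
move=> chi_neq0 + chi_char; elim: s => [_ _|psi s IHs].
  have /lfunPn[x] := chi_neq0; rewrite zero_lfunE => chix.
  by exists ((chi x : F)^-1 *: x) => //; rewrite linearZ /= [LHS]mulVf.
rewrite inE negb_or => /andP[psi_neq chiNs] s_char.
have [||b chib sb] := IHs; [by []|by move=> phi ps; apply: s_char; rewrite inE ps orbT|].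
have /lfunPn[x chi_neq_psi] := psi_neq.
have d_neq0 : (chi x : F) - psi x != 0 by rewrite subr_eq0.
(* This plays the role of [(x - psi x) b]: [psi] kills the first factor, the tail kills [b], and
   [chi] does not vanish since [x] separates it from [psi]. *)
pose d := mul x b - (psi x : F) *: b.
have chid : chi d = (chi x : F) - psi x.
  by rewrite linearB linearZ /= chi_char chib mulr1 [_ *: _]mulr1.
exists (((chi x : F) - psi x)^-1 *: d); first by rewrite linearZ /= chid [LHS]mulVf.
move=> phi; rewrite linearZ linearB linearZ /= => phis.
rewrite (s_char _ phis); move: phis; rewrite inE => /predU1P[->|/sb->].
  by rewrite -[psi x *: _]/(_ * _) subrr scaler0.
by rewrite mulr0 scaler0 subrr scaler0.
Qed.

(** The length [m] is kept apart from [size s] so that the target can be [F^n] itself; missing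
    entries default to the zero functional. *)
Definition eval_at (s : seq 'Hom(V, F^o)) m (x : V) : {ffun 'I_m -> F^o} :=
  [ffun i : 'I_m => s`_i x].

Fact eval_at_is_linear s m : linear (@eval_at s m).
Proof. by move=> a x y; apply/ffunP=> i; rewrite !ffunE linearP. Qed.

HB.instance Definition _ s m := GRing.isLinear.Build F V {ffun 'I_m -> F^o} _
  (@eval_at s m) (@eval_at_is_linear s m).

(** Faithfulness gives injectivity; interpolation gives preimages of the standard basis, hence
    surjectivity, and comparing dimensions gives the size. *)
Lemma eval_at_bij (s : seq 'Hom(V, F^o)) :
    uniq s -> 0 \notin s -> {in s, forall psi, character psi} ->
    (forall x, {in s, forall psi : 'Hom(V, F^o), psi x = 0} -> x = 0) ->
  bijective (@eval_at s (\dim {:V})) /\ size s = \dim {:V}.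
Proof.
move=> s_uniq sN0 s_char s_faithful.
pose f : 'Hom(V, {ffun 'I_(size s) -> F^o}) := linfun (@eval_at s (size s)).
have fE x (i : 'I_(size s)) : f x i = s`_i x by rewrite lfunE /= ffunE.
have f_ker0 : lker f == 0%VS.
  rewrite -subv0; apply/subvP=> x; rewrite memv_ker => /eqP fx0.
  rewrite memv0; apply/eqP/s_faithful => psi psis.
  have /(nthP 0)[i i_lt <-] := psis.
  by have := fE x (Ordinal i_lt); rewrite fx0 ffunE => <-.
have f_full : limg f = fullv.
  apply/eqP; rewrite eqEsubv subvf; apply/subvP=> y _.
  have sep (i : 'I_(size s)) : exists b, f b = [ffun j => (i == j)%:R].
    have sis : s`_i \in s by apply: mem_nth.
    have si_neq0 : s`_i != 0 by apply: contraNneq sN0 => <-.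
    have [|phi|b sib sb] := character_interpolation (s := rem s`_i s) si_neq0 _ (s_char _ sis).
    - by rewrite mem_rem_uniq // inE eqxx.
    - by move=> /mem_rem; apply: s_char.
    exists b; apply/ffunP=> j; rewrite fE ffunE.
    have [<-//|ij] := eqVneq i j; apply: sb.
    by rewrite mem_rem_uniq // inE mem_nth // nth_uniq // eq_sym ij.
  have -> : y = \sum_i (y i : F) *: [ffun j => (i == j)%:R].
    apply/ffunP=> k; rewrite sum_ffunE (bigD1 k) //= big1 ?addr0 => [|i ik].
      by rewrite !ffunE eqxx -[_ *: _]/(_ * _) mulr1.
    by rewrite !ffunE (negbTE ik) scaler0.
  apply: memv_suml => i _; apply: memvZ.
  by have [b <-] := sep i; apply: memv_img; apply: memvf.
have size_s : size s = \dim {:V}.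
  have := @limg_dim_eq _ _ _ f fullv; rewrite (eqP f_ker0) capv0 => /(_ erefl).
  by rewrite f_full dimvf /dim /= card_ord muln1.
split=> //; rewrite -size_s; apply: (@eq_bij _ _ f _ _ (lfunE _)).
exists f^-1%VF => [|y]; first exact: lker0_lfunK.
by apply: limg_lfunVK; rewrite f_full memvf.
Qed.

End Characters.

Section Coordinates.
Variables (F : fieldType) (n : nat).
Local Notation Fn := {ffun 'I_n -> F^o}.

Definition coordinate (i : 'I_n) (x : Fn) : F^o := x i.

Fact coordinate_is_linear i : linear (coordinate i).
Proof. by move=> a x y; rewrite /coordinate !ffunE. Qed.

HB.instance Definition _ i :=
  GRing.isLinear.Build F Fn F^o _ (coordinate i) (coordinate_is_linear i).

Definition coordinate_of (T : {linear Fn -> Fn}) (i : 'I_n) : 'Hom(Fn, F^o) :=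
  (linfun (coordinate i) \o linfun T)%VF.

Lemma coordinate_ofE T i x : coordinate_of T i x = T x i.
Proof. by rewrite comp_lfunE !lfunE. Qed.

Lemma coordinate_of_character (mul : Fn -> Fn -> Fn) (T : {linear Fn -> Fn}) i :
  {morph T : x y / mul x y >-> x * y} -> character mul (coordinate_of T i).
Proof. by move=> TM x y; rewrite !coordinate_ofE TM ffunE. Qed.

Lemma rota_baxter0_eq0 (R : {linear Fn -> Fn}) :
  (forall x y, R x * R y = R (R x * y + x * R y)) -> forall x, R x = 0.
Proof.
move=> rbR x0; apply/ffunP=> i; rewrite [RHS]ffunE.
pose chi := coordinate_of R i; rewrite -coordinate_ofE -/chi.
have [->|chi_neq0] := eqVneq chi 0; first by rewrite zero_lfunE.
pose s := [seq psi <- codom (coordinate_of R) | psi != chi].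
have char_R j : character (fun x y => R x * y + x * R y) (coordinate_of R j).
  by apply: coordinate_of_character => x y.
have [||x chix sx] := character_interpolation (s := s) chi_neq0 _ (char_R i).
- by rewrite mem_filter eqxx.
- by move=> psi; rewrite mem_filter => /andP[_ /codomP[j ->]].
have FnC (u v : Fn) : u * v = v * u.
  by apply/ffunP=> j; rewrite !ffunE; apply: mulrC.
(* Coordinates of [R] equal to [chi] take the value 1 at [x], all others 0. *)
pose e := R x; have ee : e * e = e.
  apply/ffunP=> j; rewrite ffunE /e -!coordinate_ofE.
  have [->|Rj_neq] := eqVneq (coordinate_of R j) chi.
    by rewrite chix [LHS]mulr1.
  by rewrite sx ?[LHS]mulr0 // mem_filter Rj_neq codom_f.
pose x' := e * x + x * e.
have Rx' : R x' = e by rewrite -rbR.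
have ex' : e * x' = x' by rewrite /x' [x * e]FnC mulrDr mulrA ee.
have e0 : e = 0.
  (* The identity at [x'] now reads [e = e + e], which forces [e = 0] in every characteristic. *)
  have := rbR x' x'; rewrite Rx' ee [x' * e]FnC ex' raddfD /= Rx'.
  by move/eqP; rewrite -subr_eq0 opprD addNKr oppr_eq0 => /eqP.
by move: chix; rewrite coordinate_ofE -/e e0 ffunE => /eqP; rewrite eq_sym oner_eq0.
Qed.

Lemma rota_baxter_bij (lambda : F) (R : {linear Fn -> Fn}) : lambda != 0 ->
    (forall x y, R x * R y = R (R x * y + x * R y + lambda *: (x * y))) ->
  exists2 f : {linear Fn -> Fn}, bijective f &
    {morph f : x y / R x * y + x * R y + lambda *: (x * y) >-> x * y}.
Proof.
move=> lambda_neq0 rbR.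
pose mul x y := R x * y + x * R y + lambda *: (x * y).
pose S : {linear Fn -> Fn} := R \+ lambda \*: idfun.
have RM : {morph R : x y / mul x y >-> x * y} by move=> x y; rewrite -rbR.
have SM : {morph S : x y / mul x y >-> x * y}.
  move=> x y; apply/ffunP=> i; rewrite /= RM !ffunE mulrDl !mulrDr.
  by rewrite -!scalerAl -!scalerAr !scalerDr !addrA.
pose s := undup [seq psi <- codom (coordinate_of R) ++ codom (coordinate_of S)
                | psi != 0].
have s_uniq : uniq s by apply: undup_uniq.
have sN0 : 0 \notin s by rewrite mem_undup mem_filter eqxx.
have s_char : {in s, forall psi, character mul psi}.
  move=> psi; rewrite mem_undup mem_filter mem_cat => /andP[_].
  by case/orP=> /codomP[i ->]; apply: coordinate_of_character.
have s_faithful x : {in s, forall psi : 'Hom(Fn, F^o), psi x = 0} -> x = 0.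
  move=> sx; apply: (scalerI lambda_neq0); rewrite scaler0.
  suff [Rx0 Sx0] : R x = 0 /\ S x = 0.
    by move: Sx0; rewrite /= Rx0 add0r.
  (* The functionals filtered out of [s] are zero, so vanishing on [s] means vanishing of all
     coordinates of [R x] and [S x]. *)
  have s0 psi : psi \in codom (coordinate_of R) ++ codom (coordinate_of S) ->
      psi x = 0.
    move=> psiP; have [->|psi_neq0] := eqVneq psi 0; first by rewrite zero_lfunE.
    by apply: sx; rewrite mem_undup mem_filter psi_neq0.
  by split; apply/ffunP=> i; rewrite [RHS]ffunE -coordinate_ofE s0 // mem_cat
    codom_f ?orbT.
(* As [size s = n], no default entry occurs in [eval_at s n]: each coordinate is a character. *)
have := eval_at_bij s_uniq sN0 s_char s_faithful.
rewrite dimvf /dim /= card_ord muln1 => -[f_bij size_s].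
exists (eval_at s n) => // x y; apply/ffunP=> i.
by rewrite !ffunE s_char // mem_nth // size_s.
Qed.

End Coordinates.

Theorem theorem3 (F : fieldType) (n : nat) (n_ge1 : (1 <= n)%N) (lambda : F)
    (R : {linear FnAlg F n -> FnAlg F n}) (rbR : rota_baxter lambda R) :
  (lambda = 0 -> alg_isomorphic (rb_alg rbR) (Ab F n)) /\
  (lambda <> 0 -> alg_isomorphic (rb_alg rbR) (FnAlg F n)).
Proof.
split=> [lambda0|/eqP lambda_neq0].
  have R0 : forall x, R x = 0.
    by apply: rota_baxter0_eq0 => x y; rewrite [LHS]rbR lambda0 scale0r addr0.
  exists idfun; split=> [|x y]; first by exists id.
  by rewrite /= /rb_mul !R0 lambda0 scale0r addr0 /= mul0r mulr0 addr0.
by have [f f_bij fM] := rota_baxter_bij lambda_neq0 rbR; exists f.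
Qed.
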